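(* Let $\mathcal{L}\subseteq\mathbf{Z}^n$ be a lattice of dimension $m$ and $B\in\mathbf{Z}^{n\times m}$ a matrix whose columns form a basis of $\mathcal{L}$. For $u\in\mathbf{N}^n$, the monomial $x^u$ is a standard monomial of $V_{\mathcal{L}}$ (i.e. $x^u\notin V_{\mathcal{L}}$) if and only if the origin is a vertex of $R_u$. Moreover, for $u\in\mathbf{N}^n$ and $\tau\subseteq[n]$, the pair $(x^u,\tau)$ is a standard pair of $V_{\mathcal{L}}$ if and only if the origin is a vertex of $R^{\bar\tau}_u$ and the origin is not a vertex of $R^{\bar\tau\setminus i}_u$ for any $i\in\bar\tau$.
   Context: $S=k[x_1,\ldots,x_n]$, $x^u=\prod_i x_i^{u_i}$, $\mathrm{supp}(u)=\{i:u_i\neq0\}$, $[n]=\{1,\ldots,n\}$. For $u\in\mathbf{N}^n$ the fiber is $P_u=\mathrm{conv}\{v\in\mathbf{N}^n: u-v\in\mathcal{L}\}$; the vertex ideal $V_{\mathcal{L}}$ is the monomial ideal spanned by monomials $x^v$ with $v$ not a vertex of $P_v$. For $\tau\subseteq[n]$ write $\bar\tau=[n]\setminus\tau$. For $u\in\mathbf{N}^n$ and $\sigma\subseteq[n]$, let $Q^{\sigma}_u=\{x\in\mathbf{R}^m: B^{\sigma}x\le u^{\sigma}\}$, where $B^\sigma,u^\sigma$ keep only the rows/coordinates indexed by $\sigma$, and let $R^\sigma_u$ be the convex hull of $Q^\sigma_u\cap\mathbf{Z}^m$; $Q_u=Q^{[n]}_u$, $R_u=R^{[n]}_u$. Standard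 pairs: an admissible pair of a monomial ideal $M$ is a pair $(x^u,\tau)$ with $\tau\subseteq[n]$, $\mathrm{supp}(u)\cap\tau=\emptyset$, and $x^{u+v}\notin M$ for all $v\in\mathbf{N}^n$ with $\mathrm{supp}(v)\subseteq\tau$. Order admissible pairs by $(x^u,\tau)\prec(x^v,\sigma)$ if $x^v\mid x^u$ and $\mathrm{supp}(u-v)\cup\tau\subseteq\sigma$; standard pairs are the maximal admissible pairs.
   Formalization: In the second part the pair (x^u, τ) is assumed to satisfy supp(u) ∩ τ = ∅; without this the ''if'' direction fails, e.g. for n = 1, L = 0 and the pair (x_1, {1}). *)

(* Defs.v *)
From HB Require Import structures.
From mathcomp Require Export all_boot all_order all_algebra.
From mathcomp Require Export boolp classical_sets reals.
From mathcomp Require Export mpoly.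

Set Implicit Arguments.
Unset Strict Implicit.
Unset Printing Implicit Defensive.

Import Order.TTheory GRing.Theory Num.Theory.
Local Open Scope classical_set_scope.
Local Open Scope ring_scope.

(* Vectors are columns, so that B : 'M_(n, m) acts by B *m z.  An exponent
   vector u in N^n is a multinomial u : 'X_{1..n}, and x^u is 'X_[u]. *)

Definition convex_hull (R : realType) (d : nat) (A : set 'cV[R]_d) :
    set 'cV[R]_d :=
  [set x | exists (N : nat) (c : 'I_N -> R) (p : 'I_N -> 'cV[R]_d),
     [/\ forall j, 0 <= c j, \sum_j c j = 1, forall j, A (p j)
       & x = \sum_j c j *: p j]].

(* Faces are cut out by valid linear inequalities a x <= b. *)
Definition is_face (R : realType) (d : nat) (C F : set 'cV[R]_d) : Prop :=
  exists (a : 'rV[R]_d) (b : R),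
    (forall x, C x -> (a *m x) 0 0 <= b) /\
    F = [set x | C x /\ (a *m x) 0 0 = b].

Definition is_vertex (R : realType) (d : nat) (C : set 'cV[R]_d)
    (x : 'cV[R]_d) : Prop :=
  is_face C [set x].

Definition is_lattice_basis (n m : nat) (L : {pred 'cV[int]_n})
    (B : 'M[int]_(n, m)) : Prop :=
  (forall v, v \in L <-> exists z : 'cV[int]_m, v = B *m z) /\
  (forall z : 'cV[int]_m, B *m z = 0 -> z = 0).

Definition real_vec (R : realType) (n : nat) (u : 'X_{1..n}) : 'cV[R]_n :=
  \col_i (u i)%:R.

Definition fiber (R : realType) (n : nat) (L : {pred 'cV[int]_n})
    (u : 'X_{1..n}) : set 'cV[R]_n :=
  convex_hull [set real_vec R v | v in
    [set v : 'X_{1..n} | (\col_i ((u i)%:Z - (v i)%:Z)) \in L]].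

Definition ideal_gen (k : fieldType) (n : nat) (A : set {mpoly k[n]}) :
    set {mpoly k[n]} :=
  [set p | exists (N : nat) (q g : 'I_N -> {mpoly k[n]}),
     (forall j, A (g j)) /\ p = \sum_j q j * g j].

Definition vertex_ideal (R : realType) (k : fieldType) (n : nat)
    (L : {pred 'cV[int]_n}) : set {mpoly k[n]} :=
  ideal_gen [set 'X_[v] | v in
    [set v : 'X_{1..n} | ~ is_vertex (fiber L v) (real_vec R v)]].

Definition Qpoly (R : realType) (n m : nat) (B : 'M[int]_(n, m))
    (sigma : {set 'I_n}) (u : 'X_{1..n}) : set 'cV[R]_m :=
  [set x | forall i, i \in sigma ->
     (map_mx (intr : int -> R) B *m x) i 0 <= (u i)%:R].

Definition int_points (R : realType) (m : nat) : set 'cV[R]_m :=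
  range (map_mx (intr : int -> R)).

Definition Rpoly (R : realType) (n m : nat) (B : 'M[int]_(n, m))
    (sigma : {set 'I_n}) (u : 'X_{1..n}) : set 'cV[R]_m :=
  convex_hull (Qpoly B sigma u `&` @int_points R m).

Definition msupp_set (n : nat) (u : 'X_{1..n}) : {set 'I_n} :=
  [set i | u i != 0%N].

(* The pair (u, tau) stands for (x^u, tau). *)
Definition admissible_pair (k : fieldType) (n : nat) (M : set {mpoly k[n]})
    (p : 'X_{1..n} * {set 'I_n}) : Prop :=
  msupp_set p.1 :&: p.2 = finset.set0 /\
  (forall v : 'X_{1..n}, msupp_set v \subset p.2 -> ~ M 'X_[p.1 + v]).

(* The first conjunct is divisibility x^v | x^u, so u - v is not truncated. *)
Definition pair_le (n : nat) (p q : 'X_{1..n} * {set 'I_n}) : Prop :=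
  (q.1 <= p.1)%MM /\ msupp_set (p.1 - q.1)%MM :|: p.2 \subset q.2.

Definition standard_pair (k : fieldType) (n : nat) (M : set {mpoly k[n]})
    (p : 'X_{1..n} * {set 'I_n}) : Prop :=
  admissible_pair M p /\
  (forall q, admissible_pair M q -> pair_le p q -> q = p).

(* Main.v *)
(* The origin is a vertex of R_u^sigma iff some functional c is negative on all
   nonzero integer z with (B z)_i <= u_i for i in sigma, and z |-> u - B z
   carries this to the fiber of u.  The point needing care is admissibility of
   (x^u, tau): the monomials x^(u+v) with supp v in tau each come with their own
   c, whereas the relaxation R_u^(~ tau) requires a single one.  As in the
   construction of a Graver basis, Dickson's lemma applied to the positive and
   negative parts of B z gives a bound N such that every nonzero z dominates,
   with matching signs, a nonzero y with B y <= N.  Since z - y still satisfies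
   the constraints, c is negative on all admissible z as soon as it is negative
   on those with B z <= N.  Hence the c found for a v with entries N on tau
   works for R_u^(~ tau). *)

Require Import Defs.
From mathcomp Require Import zify lra.
Import Order.TTheory GRing.Theory Num.Theory.
Local Open Scope ring_scope.

Set Implicit Arguments.
Unset Strict Implicit.
Unset Printing Implicit Defensive.

(** * Dickson's lemma and bounded conformal vectors *)

Lemma dickson (I : finType) (P : (I -> nat) -> Prop) :
  exists N, forall x, P x ->
    exists y, [/\ P y, forall i, (y i <= x i)%N & forall i, (y i <= N)%N].
Proof.
suff H k (T : {set I}) (Q : (I -> nat) -> Prop) : (#|~: T| <= k)%N ->
    (forall x y, Q x -> Q y -> forall i, i \in T -> x i = y i) ->
    exists N, forall x, Q x ->
      exists y, [/\ Q y, forall i, (y i <= x i)%N & forall i, (y i <= N)%N].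
  by apply: (H #|~: @finset.set0 I|%N finset.set0) => // x y _ _ i; rewrite inE.
(* Induct on the number of coordinates on which Q is not constant: fixing p in Q,
   any x not above p has x i = j for some free i and some j < p i. *)
elim: k T Q => [|k IHk] T Q leTk eqT.
  have inT i : i \in T.
    by move: leTk; rewrite leqn0 cards_eq0 => /eqP/setP/(_ i);
      rewrite !inE => /negbFE.
  have [[p Qp]|noQ] := pselect (exists p, Q p); last first.
    by exists 0%N => x Qx; case: noQ; exists x.
  exists (\max_i p i) => x Qx; exists x; split => // i.
  by rewrite (eqT x p) //; apply: (leq_bigmax i).
have [[p Qp]|noQ] := pselect (exists p, Q p); last first.
  by exists 0%N => x Qx; case: noQ; exists x.
(* The condition [ij.1 \notin T] stands under the existential so that [choice] yields a bound for
   every pair, of which there are finitely many. *)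
have bnd (ij : I * 'I_(\max_i p i)) : exists N, ij.1 \notin T -> forall x,
    Q x /\ x ij.1 = ij.2 -> exists y, [/\ Q y /\ y ij.1 = ij.2,
      forall i, (y i <= x i)%N & forall i, (y i <= N)%N].
  case: ij => i j /=; have [iT|iT] := boolP (i \in T); first by exists 0%N.
  have [||N HN] := IHk (i |: T) (fun x => Q x /\ x i = j).
  - have := cardsC T; have := cardsC (i |: T); rewrite cardsU1 iT /=; lia.
  - move=> x y [Qx xi] [Qy yi] l; rewrite !inE => /predU1P[->|lT].
      by rewrite xi yi.
    exact: eqT.
  by exists N.
have [N HN] := choice bnd.
exists (maxn (\max_i p i) (\max_ij N ij)) => x Qx.
have [lepx|] := boolP [forall i, p i <= x i]%N.
  exists p; split => // i; first exact: (forallP lepx).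
  by rewrite leq_max (leq_bigmax i).
rewrite negb_forall => /existsP[i]; rewrite -ltnNge => ltxp.
have iT : i \notin T.
  by apply/negP => iT; move: ltxp; rewrite (eqT x p) // ltnn.
have ltx : (x i < \max_i p i)%N by apply: leq_trans ltxp (leq_bigmax i).
have [y [[Qy _] leyx leyN]] := HN (i, Ordinal ltx) iT x (conj Qx erefl).
exists y; split => // l; apply: leq_trans (leyN l) _.
by rewrite leq_max (leq_bigmax (i, Ordinal ltx)) orbT.
Qed.

Definition posz_part (a : int) : nat := if a is Posz k then k else 0%N.

(** One of the two parts of [a] is zero, which forces the same part of [b] to vanish; so [b] cannot
    have the opposite sign, and the other part bounds its size. *)
Lemma posz_part_conformal (a b : int) :
  (posz_part b <= posz_part a)%N -> (posz_part (- b) <= posz_part (- a))%N ->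
  (0 <= b <= a) || (a <= b <= 0).
Proof.
have E (c : int) : (posz_part c : int) = Num.max c 0 by case: c => k /=; lia.
by have := E a; have := E b; have := E (- a); have := E (- b); lia.
Qed.

Lemma posz_part_le (b : int) (N : nat) : (posz_part b <= N)%N -> b <= N%:Z.
Proof. by case: b => k /=; lia. Qed.

Lemma bounded_conformal (n m : nat) (B : 'M[int]_(n, m)) :
  exists N : nat, forall z : 'cV[int]_m, z != 0 ->
    exists y : 'cV[int]_m, [/\ y != 0,
      forall i, (0 <= (B *m y) i 0 <= (B *m z) i 0) ||
                ((B *m z) i 0 <= (B *m y) i 0 <= 0)
      & forall i, (B *m y) i 0 <= N%:Z].
Proof.
pose code (z : 'cV[int]_m) (ib : 'I_n * bool) :=
  posz_part (if ib.2 then (B *m z) ib.1 0 else - (B *m z) ib.1 0).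
have [N HN] :=
  dickson (fun x => exists2 z : 'cV[int]_m, z != 0 & x = code z).
exists N => z z0.
have [|_ [[y y0 ->] leyz leyN]] := HN (code z); first by exists z.
exists y; split => // i; last exact: posz_part_le (leyN (i, true)).
exact: posz_part_conformal (leyz (i, true)) (leyz (i, false)).
Qed.

(** * Separating functionals on integer points *)

(** The certificate shared by all vertex statements below: [c] attains its maximum over the integer
    points of the relaxation only at the origin. *)
Definition separates (R : realType) (n m : nat) (B : 'M[int]_(n, m))
    (sigma : {set 'I_n}) (u : 'X_{1..n}) (c : 'rV[R]_m) : Prop :=
  forall z : 'cV[int]_m, z != 0 ->
    (forall i, i \in sigma -> (B *m z) i 0 <= (u i)%:Z) ->
    (c *m map_mx intr z) 0 0 < 0.

Lemma separates_sub (R : realType) (n m : nat) (B : 'M[int]_(n, m))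
    (sigma rho : {set 'I_n}) (u v : 'X_{1..n}) (c : 'rV[R]_m) :
  rho \subset sigma -> (forall i, i \in rho -> (u i <= v i)%N) ->
  separates B rho v c -> separates B sigma u c.
Proof.
move=> sub leuv sep z z0 Hz; apply: sep => // i irho.
by apply: le_trans (Hz i (fintype.subsetP sub i irho)) _; rewrite lez_nat leuv.
Qed.

Lemma separates_bounded (R : realType) (n m : nat) (B : 'M[int]_(n, m)) :
  (forall z : 'cV[int]_m, B *m z = 0 -> z = 0) ->
  exists N : nat, forall (sigma : {set 'I_n}) (u v : 'X_{1..n}) (c : 'rV[R]_m),
    (forall i, i \in sigma -> (v i <= u i)%N) ->
    (forall i, i \notin sigma -> (N <= u i)%N) ->
    separates B [set: 'I_n]%SET u c -> separates B sigma v c.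
Proof.
move=> injB; have [N HN] := bounded_conformal B.
exists N => sigma u v c levu leNu sep z.
(* Induction on the 1-norm of [B *m z], which drops when the conformal vector [y] is subtracted. *)
have [k] := ubnP (\sum_i absz ((B *m z) i 0)%R)%N.
elim: k z => // k IHk z ltk z0 Hz.
have [y [y0 conf leyN]] := HN z z0.
(* Conformality puts the entry of [B *m y] below the larger of 0 and that of [B *m z], and both are
   at most [v i]. *)
have ney i : i \in sigma -> (B *m y) i 0 <= (v i)%:Z.
  by move=> /Hz; have := conf i; lia.
have cy : (c *m map_mx intr y) 0 0 < 0.
  apply: sep => // i _; have [isg|isg] := boolP (i \in sigma).
    by have := ney i isg; have := levu i isg; lia.
  by have := leyN i; have := leNu i isg; lia.
have [zy|zy] := eqVneq (z - y) 0; first by rewrite (subr0_eq zy).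
have EB i : (B *m (z - y)) i 0 = (B *m z) i 0 - (B *m y) i 0.
  by rewrite mulmxBr !mxE.
have : (c *m map_mx intr (z - y)) 0 0 < 0.
  apply: IHk => //.
    apply: leq_trans (_ : _ < \sum_i absz ((B *m z) i 0)%R)%N _ => //.
    (* Injectivity of [B] gives a coordinate where the norm drops strictly; elsewhere it does not
       grow. *)
    have [i Byi] : exists i, (B *m y) i 0 != 0.
      apply/existsP; apply: contraNT y0; rewrite negb_exists => /forallP By.
      apply/eqP/injB/matrixP => i j; rewrite ord1 [RHS]mxE.
      by apply/eqP; rewrite -[_ == _]negbK By.
    rewrite (bigD1 i) //= [X in (_ < X)%N](bigD1 i) //= -addSn.
    apply: leq_add; last (apply: leq_sum => l _); rewrite EB.
      by move: Byi (conf i); move: (_ i 0) (_ i 0) => a b; lia.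
    by move: (conf l); move: (_ l 0) (_ l 0) => a b; lia.
  (* Where [B *m y] is nonnegative, subtracting it only lowers the entry; where it is negative, the
     difference is at most 0. *)
  by move=> i isg; rewrite EB; have := conf i; have := Hz i isg; lia.
by rewrite map_mxB mulmxBr !mxE in cy *; lra.
Qed.

(** * Vertices of hulls and of fibers *)

(** A convex combination attaining the maximum of [a] cannot give positive weight to a point where
    [a] is strictly smaller, so only [x] itself remains. *)
Lemma hull_vertexP (R : realType) (d : nat) (A : set 'cV[R]_d) (x : 'cV[R]_d) :
  A x ->
  is_vertex (convex_hull A) x <->
  exists a : 'rV[R]_d, forall p, A p -> p != x -> (a *m p) 0 0 < (a *m x) 0 0.
Proof.
move=> Ax.
have subA p : A p -> convex_hull A p.
  move=> Ap; exists 1%N, (fun=> 1), (fun=> p).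
  by split=> //; rewrite big_ord1 ?scale1r.
split=> [[a [b [leb eqF]]]|[a lta]].
  have : [set x]%classic x by [].
  rewrite eqF => -[_ axb]; exists a => p Ap npx.
  rewrite axb lt_neqAle leb ?andbT; last exact: subA.
  apply: contraNneq npx => apb; apply/eqP.
  by have : [set x]%classic p by rewrite eqF; split=> //; apply: subA.
have lea p : A p -> (a *m p) 0 0 <= (a *m x) 0 0.
  by move=> Ap; have [->//|/(lta p Ap)/ltW] := eqVneq p x.
have comb N (c : 'I_N -> R) (p : 'I_N -> 'cV[R]_d) :
    (a *m (\sum_j c j *: p j)) 0 0 = \sum_j c j * (a *m p j) 0 0.
  rewrite mulmx_sumr summxE; apply: eq_bigr => j _.
  by rewrite -scalemxAr mxE.
exists a, ((a *m x) 0 0); split.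
  move=> _ [N [c [p [c0 c1 Ap ->]]]]; rewrite comb.
  rewrite -[leRHS]mul1r -c1 mulr_suml; apply: ler_sum => j _.
  by rewrite ler_wpM2l ?lea.
apply/seteqP; split=> [_ ->|]; first by split=> //; exact: subA.
move=> _ [[N [c [p [c0 c1 Ap ->]]]]]; rewrite comb => eqax /=.
(* Weights times gaps to the maximum are nonnegative with sum 0, so each product vanishes. *)
have /eqP : \sum_j c j * ((a *m x) 0 0 - (a *m p j) 0 0) = 0.
  under eq_bigr do rewrite mulrBr.
  by rewrite sumrB -mulr_suml c1 mul1r eqax subrr.
rewrite psumr_eq0 => [/allP all0|j _]; last by rewrite mulr_ge0 ?subr_ge0 ?lea.
rewrite -[RHS]scale1r -c1 scaler_suml; apply: eq_bigr => j _.
have [->//|npx] := eqVneq (p j) x.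
have := all0 j (mem_index_enum j).
rewrite /= mulf_eq0 subr_eq0 => /orP[/eqP->|/eqP eqa]; first by rewrite !scale0r.
by have := lta _ (Ap j) npx; rewrite eqa ltxx.
Qed.

Lemma map_intr_eq0 (R : realType) (m : nat) (z : 'cV[int]_m) :
  (map_mx (intr : int -> R) z == 0) = (z == 0).
Proof.
apply/eqP/eqP => [/matrixP E|->]; last by rewrite map_mx0.
apply/matrixP => i j; apply/eqP; have := E i j.
by rewrite !mxE => /eqP; rewrite intr_eq0.
Qed.

Lemma Rpoly_vertexP (R : realType) (n m : nat) (B : 'M[int]_(n, m))
    (sigma : {set 'I_n}) (u : 'X_{1..n}) :
  is_vertex (@Rpoly R n m B sigma u) 0 <->
  exists c : 'rV[R]_m, separates B sigma u c.
Proof.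
have QE (z : 'cV[int]_m) : @Qpoly R n m B sigma u (map_mx intr z) <->
    forall i, i \in sigma -> (B *m z) i 0 <= (u i)%:Z.
  rewrite /Qpoly /= -map_mxM; split=> H i /H;
    by rewrite [map_mx _ _ i 0]mxE /= [(u i)%:R]pmulrn ler_int.
have Q0 : (@Qpoly R n m B sigma u `&` @int_points R m)%classic 0.
  by split; [move=> i _; rewrite mulmx0 mxE | exists 0; rewrite ?map_mx0].
rewrite (hull_vertexP Q0); split=> -[c Hc]; exists c.
  move=> z z0 /QE Qz; have := Hc (map_mx intr z).
  by rewrite mulmx0 [ltRHS]mxE map_intr_eq0; apply=> //; split=> //; exists z.
move=> _ [/[swap] -[z _ <-] /QE Qz]; rewrite map_intr_eq0 => z0.
by rewrite mulmx0 [ltRHS]mxE; apply: Hc.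
Qed.

(** Rank does not change from the rationals to [R], and a rational kernel vector becomes an integral
    one once denominators are cleared. This provides the left inverse used to move functionals to
    the fiber. *)
Lemma map_intr_row_full (R : realType) (n m : nat) (B : 'M[int]_(n, m)) :
  (forall z : 'cV[int]_m, B *m z = 0 -> z = 0) ->
  row_full (map_mx (intr : int -> R) B).
Proof.
move=> injB.
have -> : map_mx (intr : int -> R) B = map_mx ratr (map_mx (intr : int -> rat) B).
  by apply/matrixP => i j; rewrite !mxE ratr_int.
rewrite row_full_map /row_full -mxrank_tr -/(row_free _) -kermx_eq0.
set K := kermx _; apply/eqP/row_matrixP => i; rewrite row0.
have : row i K *m (map_mx (intr : int -> rat) B)^T = 0.
  by rewrite -row_mul mulmx_ker row0.
move: (row i K) => v vB.
pose d : int := \prod_j denq (v 0 j).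
have d0 : d != 0 by apply/prodf_neq0 => j _; rewrite denq_neq0.
pose z : 'cV[int]_m := \col_j (numq (v 0 j) * \prod_(l | l != j) denq (v 0 l)).
have zE : map_mx (intr : int -> rat) z = d%:~R *: v^T.
  apply/matrixP => j l; rewrite ord1 !mxE [d](bigD1 j) //= !intrM numqE.
  by rewrite -[LHS]mulrA [LHS]mulrC.
have /injB z0 : B *m z = 0.
  apply/eqP; rewrite -(map_intr_eq0 R); apply/eqP/matrixP => a b.
  have : map_mx (intr : int -> rat) (B *m z) = 0.
    by rewrite map_mxM zE -scalemxAr -[map_mx _ B]trmxK -trmx_mul vB trmx0 scaler0.
  by move/matrixP/(_ a b); rewrite !mxE => /eqP; rewrite intr_eq0 => /eqP ->.
move: zE; rewrite z0 map_mx0 => /esym/eqP; rewrite scalemx_eq0 intr_eq0 (negbTE d0) /=.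
by move=> /eqP vT0; rewrite -[v]trmxK vT0 trmx0.
Qed.

(** Points of the fiber are [u - B z], so a functional [a] there pulls back to [- a B]; conversely
    [c] comes from [- c D] with [D] a left inverse of [B]. *)
Lemma fiber_vertexP (R : realType) (n m : nat) (L : {pred 'cV[int]_n})
    (B : 'M[int]_(n, m)) (u : 'X_{1..n}) : is_lattice_basis L B ->
  is_vertex (@fiber R n L u) (real_vec R u) <->
  exists c : 'rV[R]_m, separates B [set: 'I_n]%SET u c.
Proof.
move=> [LB injB].
have eqB (v : 'X_{1..n}) z : \col_i ((u i)%:Z - (v i)%:Z) = B *m z ->
    real_vec R v = real_vec R u - map_mx intr B *m map_mx intr z.
  move=> uvB; rewrite -map_mxM -uvB; apply/matrixP => i j.
  by rewrite !mxE rmorphB /= -!pmulrn opprB addrC subrK.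
rewrite hull_vertexP; last first.
  exists u => //=; apply/LB; exists 0; rewrite mulmx0.
  by apply/matrixP => i j; rewrite !mxE subrr.
split=> [[a lta]|[c sep]].
  exists (- (a *m map_mx intr B)) => z z0 Bz.
  (* The constraints on [z] make these entries nonnegative, so [absz] leaves them unchanged. *)
  pose v : 'X_{1..n} := [multinom absz ((u i)%:Z - (B *m z) i 0)%R | i < n].
  have uvB : \col_i ((u i)%:Z - (v i)%:Z) = B *m z.
    apply/matrixP => i j; rewrite ord1 mxE mnmE.
    by have := Bz i; rewrite inE => /(_ isT); move: (_ i 0) (u i) => b c; lia.
  have : (a *m real_vec R v) 0 0 < (a *m real_vec R u) 0 0.
    apply: lta; first by exists v => //=; apply/LB; exists z.
    rewrite (eqB _ _ uvB) -subr_eq0 addrC addKr oppr_eq0 -map_mxM map_intr_eq0.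
    by apply: contra z0 => /eqP/injB/eqP.
  rewrite (eqB _ _ uvB) mulmxBr mulmxA mulNmx.
  by move: (a *m _) (a *m _ *m _) => p q; rewrite !mxE; lra.
have /row_fullP[D DB] := map_intr_row_full R injB.
exists (- (c *m D)) => _ [v /= /LB[z uvB] <-]; rewrite (eqB _ _ uvB) => nvu.
have : (c *m map_mx intr z) 0 0 < 0.
  apply: sep => [|i _].
    by apply: contra nvu => /eqP ->; rewrite map_mx0 mulmx0 subr0.
  by rewrite -uvB mxE; lia.
rewrite mulmxBr mulmxA !mulNmx -(mulmxA c D (map_mx _ B)) DB mulmx1.
by move: (c *m _) (c *m _ *m _) => p q; rewrite !mxE; lra.
Qed.

(** * Standard monomials and standard pairs *)

Lemma standard_monomialP (R : realType) (k : fieldType) (n m : nat)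
    (L : {pred 'cV[int]_n}) (B : 'M[int]_(n, m)) (u : 'X_{1..n}) :
  is_lattice_basis L B ->
  ~ @vertex_ideal R k n L 'X_[u] <->
  exists c : 'rV[R]_m, separates B [set: 'I_n]%SET u c.
Proof.
move=> hB; split=> [Vu|[c sep] [N [q [g [Hg Xu]]]]].
  rewrite -(fiber_vertexP R u hB); apply: contrapT => Hu; apply: Vu.
  exists 1%N, (fun=> 1), (fun=> 'X_[u]); split; first by move=> _; exists u.
  by rewrite big_ord1 mul1r.
(* Some summand contains the monomial ['X_[u]], so its generator ['X_[v]] divides ['X_[u]]; then [c]
   also works for the smaller [v], which makes [v] a vertex of its own fiber. *)
have [j qgj] : exists j, (q j * g j)@_u != 0.
  apply/existsP; apply: contraT; rewrite negb_exists => /forallP all0.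
  have := congr1 (mcoeff u) Xu; rewrite mcoeffX eqxx raddf_sum big1 /=.
    by move/eqP; rewrite oner_eq0.
  by move=> j _; apply/eqP; rewrite -[_ == _]negbK all0.
have [v Hv gv] := Hg j; apply: Hv; apply/(fiber_vertexP R v hB); exists c.
apply: separates_sub sep => // i _; apply/mnm_lepP.
apply: contraNT qgj => nle; rewrite -gv mcoeffMr big1 // => -[a b] /= /eqP uab.
rewrite mcoeffX; case: eqVneq => [va|]; last by rewrite mulr0.
by case/negP: nle; rewrite uab va lem_addr.
Qed.

Lemma admissible_pairP (R : realType) (k : fieldType) (n m : nat)
    (L : {pred 'cV[int]_n}) (B : 'M[int]_(n, m)) (u : 'X_{1..n})
    (tau : {set 'I_n}) : is_lattice_basis L B ->
  msupp_set u :&: tau = finset.set0 ->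
  admissible_pair (@vertex_ideal R k n L) (u, tau) <->
  is_vertex (@Rpoly R n m B (~: tau) u) 0.
Proof.
move=> hB utau; rewrite Rpoly_vertexP; split=> [[_ adm]|[c sep]].
  have [N HN] := separates_bounded R hB.2.
  pose v : 'X_{1..n} := [multinom if i \in tau then N else 0%N | i < n].
  have [|c sep] := (standard_monomialP R k (u + v)%MM hB).1.
    apply: adm; apply/fintype.subsetP => i; rewrite inE mnmE.
    by case: ifP.
  exists c; apply: HN sep => i; rewrite inE !mnmE ?negbK; first by rewrite leq_addr.
  by move=> ->; rewrite leq_addl.
split=> //= v vtau; apply/(standard_monomialP R k _ hB); exists c.
apply: separates_sub sep; first exact: finset.subsetT.
(* Outside [tau] the exponent [v] is 0, so the constraints of [u + v] there are those of [u]. *)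
move=> i; rewrite inE mnmDE => itau; have [->|vi] := eqVneq (v i) 0%N.
  by rewrite addn0.
by case/negP: itau; apply: (fintype.subsetP vtau); rewrite inE.
Qed.

Theorem theorem3p6 (R : realType) (k : fieldType) (n m : nat)
    (L : {pred 'cV[int]_n}) (B : 'M[int]_(n, m))
    (hL : zmod_closed L) (hB : is_lattice_basis L B) :
  (forall u : 'X_{1..n},
     ~ @vertex_ideal R k n L 'X_[u] <->
     is_vertex (@Rpoly R n m B [set: 'I_n]%SET u) 0) /\
  (forall (u : 'X_{1..n}) (tau : {set 'I_n}),
     msupp_set u :&: tau = finset.set0 ->
     (standard_pair (@vertex_ideal R k n L) (u, tau) <->
      is_vertex (@Rpoly R n m B (~: tau) u) 0 /\
      (forall i : 'I_n, i \in ~: tau ->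
         ~ is_vertex (@Rpoly R n m B (~: tau :\ i) u) 0))).
Proof.
split=> [u|u tau utau]; first by rewrite Rpoly_vertexP; apply: standard_monomialP.
rewrite -(admissible_pairP R k hB utau); split=> [[adm maxl]|[adm noi]]; split=> //.
  move=> i; rewrite inE => itau /Rpoly_vertexP[c sep].
  (* Setting entry [i] of [u] to 0 and adding [i] to [tau] gives a strictly larger admissible pair,
     against maximality. *)
  pose v : 'X_{1..n} := [multinom if j == i then 0%N else u j | j < n].
  have vtau : msupp_set v :&: (i |: tau) = finset.set0.
    apply/setP => j; have /setP/(_ j) := utau.
    by rewrite !inE mnmE; case: (j == i).
  have admv : admissible_pair (@vertex_ideal R k n L) (v, i |: tau).
    rewrite (admissible_pairP R k hB vtau) Rpoly_vertexP; exists c.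
    apply: separates_sub sep.
      by apply/fintype.subsetP => j; rewrite !inE negb_or.
    by move=> j; rewrite !inE => /andP[/negbTE ji _]; rewrite mnmE ji.
  suff le_uv : pair_le (u, tau) (v, i |: tau).
    by have [_ tauE] := maxl _ admv le_uv; rewrite -tauE setU11 in itau.
  split=> /=; first by apply/mnm_lepP => j; rewrite mnmE; case: ifP.
  rewrite finset.subUset finset.subsetUr andbT; apply/fintype.subsetP => j.
  by rewrite !inE !mnmE; case: (j == i); rewrite ?subnn.
move=> [v sigma] admv [/= /mnm_lepP levu]; rewrite finset.subUset => /andP[usub tsub].
have [itau|] := boolP (sigma \subset tau).
  have -> : sigma = tau by apply/eqP; rewrite finset.eqEsubset itau.
  (* A coordinate where [v] is below [u] would lie in both [tau] and the support of [u]. *)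
  congr pair; apply/mnmP => i; have [//|nuv] := eqVneq (v i) (u i).
  have : i \in msupp_set u :&: tau.
    have ltvu : (v i < u i)%N by rewrite ltn_neqAle nuv levu.
    rewrite inE [X in X && _]inE -lt0n (leq_ltn_trans _ ltvu) //=.
    apply: (fintype.subsetP itau); apply: (fintype.subsetP usub).
    by rewrite inE mnmBE subn_eq0 -ltnNge.
  by rewrite utau inE.
(* With [i] in [sigma] but not in [tau], the functional for [(v, sigma)] serves [u] without row [i],
   since [u] and [v] agree outside [sigma]. *)
case/fintype.subsetPn => i isig itau; case: (noi i); first by rewrite inE.
move/(admissible_pairP R k hB admv.1)/Rpoly_vertexP: admv => [c sep].
apply/Rpoly_vertexP; exists c; apply: separates_sub sep.
  apply/fintype.subsetP => j; rewrite !inE => jsig; apply/andP; split.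
    by apply: contraNneq jsig => ->.
  by apply: contra jsig; apply: (fintype.subsetP tsub).
move=> j; rewrite inE => jsig; have [//|ltvu] := leqP (u j) (v j).
case/negP: jsig; apply: (fintype.subsetP usub).
by rewrite inE mnmBE subn_eq0 -ltnNge.
Qed.
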